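(* The generating function $R(z)=\sum_{n\ge 1} r_n z^n$ for the number $r_n$ of reduced tree pairs with $n$ carets in each tree is not algebraic.
   Context: A caret is a pair of edges joining two vertices to a common parent. A finite rooted binary tree with $n$ carets (i.e. $n$ internal nodes) has $n+1$ leaves, numbered from left to right. An $n$-caret tree pair is an ordered pair of rooted binary trees each having $n$ carets. An exposed caret is a caret both of whose children are leaves. A tree pair with at least two carets in each tree is unreduced if, for some $k$, both trees contain an exposed caret with leaves numbered $k$ and $k+1$; otherwise it is reduced (in particular the pair of single carets is reduced). $r_n$ denotes the number of reduced tree pairs with $n$ carets in each tree, with $r_0=0$ and $r_1=1$. A power series is algebraic if it satisfies a nontrivial polynomial equation whose coefficients are polynomials in $z$. *)

(* Defs.v *)
From HB Require Import structures.
From mathcomp Require Import all_boot all_order all_algebra.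

Set Implicit Arguments.
Unset Strict Implicit.
Unset Printing Implicit Defensive.

Import GRing.Theory.

Inductive bintree : Type := Leaf | Node of bintree & bintree.

Fixpoint tree_encode (t : bintree) : GenTree.tree void :=
  if t is Node l r then GenTree.Node 1 [:: tree_encode l; tree_encode r]
  else GenTree.Node 0 [::].

Fixpoint tree_decode (g : GenTree.tree void) : option bintree :=
  match g with
  | GenTree.Node 0 [::] => Some Leaf
  | GenTree.Node 1 [:: g1; g2] =>
      if (tree_decode g1, tree_decode g2) is (Some l, Some r)
      then Some (Node l r) else None
  | _ => None
  end.

Lemma tree_encodeK : pcancel tree_encode tree_decode.
Proof. by elim=> [|l IHl r IHr] //=; rewrite IHl IHr. Qed.

HB.instance Definition _ := Countable.copy bintree (pcan_type tree_encodeK).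

Fixpoint carets (t : bintree) : nat :=
  if t is Node l r then (carets l + carets r).+1 else 0.

Fixpoint leaves (t : bintree) : nat :=
  if t is Node l r then leaves l + leaves r else 1.

(* The numbers of the left leaves of the exposed carets of t, when the leaves *)
(* of t are numbered from left to right starting from k; the right leaf of an *)
(* exposed caret always bears the next number.                                *)
Fixpoint exposed_from (k : nat) (t : bintree) : seq nat :=
  match t with
  | Leaf => [::]
  | Node Leaf Leaf => [:: k]
  | Node l r => exposed_from k l ++ exposed_from (k + leaves l) r
  end.

Definition exposed (t : bintree) : seq nat := exposed_from 0 t.

Record ntree (n : nat) : Type :=
  NTree { tree_of :> bintree; _ : carets tree_of == n }.

HB.instance Definition _ n := [isSub for @tree_of n].
HB.instance Definition _ n := [Countable of ntree n by <:].

(* All trees with at most m nested carets; only used for finiteness.          *)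
Fixpoint trees_upto (m : nat) : seq bintree :=
  if m is m'.+1 then
    Leaf :: [seq Node l r | l <- trees_upto m', r <- trees_upto m']
  else [:: Leaf].

Lemma mem_trees_upto m t : carets t <= m -> t \in trees_upto m.
Proof.
elim: m t => [|m IHm] [|l r] //=; rewrite ltnS => le_m.
rewrite inE /=; apply/allpairsP; exists (l, r).
split=> //=; apply: IHm; apply: leq_trans le_m; [exact: leq_addr | exact: leq_addl].
Qed.

Definition ntree_enum n : seq (ntree n) := undup (pmap insub (trees_upto n)).

Lemma ntree_enumP n : Finite.axiom (ntree_enum n).
Proof.
move=> t; rewrite count_uniq_mem ?undup_uniq // mem_undup mem_pmap_sub.
by rewrite mem_trees_upto // (eqP (valP t)).
Qed.

HB.instance Definition _ n := isFinite.Build (ntree n) (@ntree_enumP n).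

Definition tree_pair (n : nat) : finType := (ntree n * ntree n)%type.

Definition unreduced (n : nat) (p : tree_pair n) : bool :=
  (2 <= n) && has (fun k => k \in exposed p.2) (exposed p.1).

Definition reduced (n : nat) (p : tree_pair n) : bool := ~~ unreduced p.

(* The pair of trees without carets is not counted.                           *)
Definition num_reduced (n : nat) : nat :=
  if n is 0 then 0 else #|[set p : tree_pair n | reduced p]|.

Local Open Scope ring_scope.

Section FormalSeries.
Variable F : nzRingType.

(* A formal power series is the sequence of its coefficients.                 *)
Definition fseries : Type := nat -> F.

Definition fseries_of_poly (p : {poly F}) : fseries := fun n => p`_n.

Definition fseries_mul (f g : fseries) : fseries :=
  fun n => \sum_(i < n.+1) f i * g (n - i)%N.

Definition fseries_exp (f : fseries) (k : nat) : fseries :=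
  iter k (fseries_mul f) (fseries_of_poly 1).

(* P is a polynomial in y whose coefficients are polynomials in z; the value  *)
(* at y = f(z) is computed coefficientwise in z.                              *)
Definition fseries_eval (P : {poly {poly F}}) (f : fseries) : fseries :=
  fun n => \sum_(i < size P) fseries_mul (fseries_of_poly P`_i) (fseries_exp f i) n.

Definition algebraic_series (f : fseries) : Prop :=
  exists2 P : {poly {poly F}}, P != 0 & forall n, fseries_eval P f n = 0.

Definition reduced_gf : fseries := fun n => (num_reduced n)%:R.

End FormalSeries.

(* Main.v *)
Require Import Defs.
From mathcomp Require Import all_boot all_order all_algebra all_field.
From mathcomp Require Import zify ring.

Set Implicit Arguments.
Unset Strict Implicit.
Unset Printing Implicit Defensive.

Import GRing.Theory Num.Theory.

(** Let c_n be the number of trees with n carets, let C be the generating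
function of the c_n and P that of the c_n^2, and put w = z(1 - z).

From trees to a square root. Inclusion-exclusion over the exposed carets that
the two trees of a pair have in common gives R(z) = (1 - z)(P(w) - 1)
([num_reduced_congX]). As C = 1 + zC^2, the series 1 - 2zC is the square root of
1 - 4z; its coefficients are 1 and the -2c_n, whence 4zR + 1 + 4w = T(w), where
T = 1 + 4zP is the Hadamard square of the square root of 1 - 4z
([num_reduced_sqrt]).

From characteristic 0 to characteristic p. The coefficients of z^j R^i are
integers, and a determinant that is nonzero modulo p is nonzero in F. Hence an
algebraic equation for R over F forces, for every prime p, one for R modulo p
over F_p(z) whose degree in R is no larger ([int_relation_specialize]). It is
therefore enough to show that the degree of R modulo p is unbounded in p.

In characteristic p = 2s + 1. Let G be the inverse of the square root of 1 - 4z.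
Square roots of power series are unique up to sign, so G = (1 - 4z)^s G^p. As
G^p is a series in z^p and (1 - 4z)^s has degree less than p, the coefficient of
index n of G is a product of a coefficient of each factor. This passes to
squares of coefficients: the Hadamard square g of G satisfies g = B g^p, where B
is the Hadamard square of (1 - 4z)^s, and likewise T = E g^p for a polynomial E.
So R and g(w) = gamma have the same degree, and gamma = V gamma^p with V = B(w).

Raising an equation sum_j a_j gamma^j = 0 of degree d to the power p gives a
second equation, with coefficients a_j^p V^(d - j). If the degree is least
possible the two are proportional, and comparing two coefficients gives V^e a^(p-1)
= b^(p-1) with 0 < e <= d and polynomials a, b ([frobenius_relation]);
one may take a = 1, and then b has degree e. Now B is the Hasse polynomial of
the Legendre family of elliptic curves. It satisfies the Picard-Fuchs equation
of the family and therefore has simple roots ([legendre_simple_root]). So V is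
coprime to B'(w), where V' = (1 - 2z) B'(w), and the logarithmic derivative of
V^e = b^(p - 1) shows that V divides (1 - 2z) b. Thus p - 1 = deg V <= e + 1
([kummer_degree_bound]), and large p give a contradiction.

A power series f is handled through its truncations [trunc f N], modulo 'X^N for
all N. *)

(** * Exposed carets and grafting *)

Lemma leavesE t : leaves t = (carets t).+1.
Proof. by elim: t => //= l -> r ->; rewrite addnS. Qed.

Lemma leaves_gt0 t : 0 < leaves t.
Proof. by rewrite leavesE. Qed.

(** Positions relative to each subtree, in place of a list with an offset, make
the inductions below direct. *)
Fixpoint is_exposed (t : bintree) (j : nat) : bool :=
  match t with
  | Leaf => false
  | Node Leaf Leaf => j == 0
  | Node l r => is_exposed l j || (leaves l <= j) && is_exposed r (j - leaves l)
  end.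

Lemma mem_exposed t j : (j \in exposed t) = is_exposed t j.
Proof.
suff E k i : (i \in exposed_from k t) = (k <= i) && is_exposed t (i - k).
  by rewrite /exposed E subn0.
have tech a b : (a <= b) && (b - a == 0) = (b == a) by lia.
elim: t k i => [|l IHl r IHr] k i; first by rewrite andbF.
have -> : is_exposed (Node l r) (i - k) =
  if (l, r) is (Leaf, Leaf) then i - k == 0 else is_exposed l (i - k)
    || (leaves l <= i - k) && is_exposed r (i - k - leaves l).
  by case: (l) (r) => [|? ?] [|? ?].
have -> : exposed_from k (Node l r) =
  if (l, r) is (Leaf, Leaf) then [:: k] else
  exposed_from k l ++ exposed_from (k + leaves l) r.
  by case: (l) (r) => [|? ?] [|? ?].
have G : (i \in exposed_from k l ++ exposed_from (k + leaves l) r) =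
  (k <= i) && (is_exposed l (i - k)
    || (leaves l <= i - k) && is_exposed r (i - k - leaves l)).
  rewrite mem_cat IHl IHr subnDA andb_orr.
  by congr (_ || _); rewrite andbA; congr (_ && _); lia.
by case: l r G {IHl IHr} => [|? ?] [|? ?] // _; rewrite inE tech.
Qed.

Lemma is_exposed_NodeE l r j : (l, r) <> (Leaf, Leaf) ->
  is_exposed (Node l r) j =
  is_exposed l j || (leaves l <= j) && is_exposed r (j - leaves l).
Proof. by case: l r => [|? ?] [|? ?]. Qed.

Lemma both_LeafP l r : (l, r) = (Leaf, Leaf) \/ (l, r) <> (Leaf, Leaf).
Proof. by case: l r => [|? ?] [|? ?]; [left | right..]. Qed.

Lemma is_exposed_ltn t j : is_exposed t j -> j.+1 < leaves t.
Proof.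
elim: t j => [|l IHl r IHr] j //.
have [[-> ->] /eqP -> //|] := both_LeafP l r.
move=> ne; rewrite is_exposed_NodeE // => /orP [/IHl|/andP [le /IHr]] /=.
  by have := leaves_gt0 r; lia.
by have := leaves_gt0 l; lia.
Qed.

(** Two exposed carets of the same tree share no leaf. *)
Lemma is_exposed_succ t j : is_exposed t j -> ~~ is_exposed t j.+1.
Proof.
elim: t j => [|l IHl r IHr] j //.
have [[-> ->] /eqP -> //|ne] := both_LeafP l r.
rewrite !is_exposed_NodeE // => /orP [ex|/andP [le ex]]; rewrite negb_or negb_and.
  by rewrite IHl // -ltnNge is_exposed_ltn.
rewrite subSn // IHr // orbT andbT; apply/negP => /is_exposed_ltn.
by move: le; lia.
Qed.

(** Only used for [k < leaves t], where leaf number [k] is replaced by a caret. *)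
Fixpoint graft (k : nat) (t : bintree) : bintree :=
  if t is Node l r then
    if k < leaves l then Node (graft k l) r else Node l (graft (k - leaves l) r)
  else Node Leaf Leaf.

(** The inverse of [graft k] on the trees with an exposed caret at [k]. *)
Fixpoint prune (k : nat) (t : bintree) : bintree :=
  match t with
  | Leaf => Leaf
  | Node Leaf Leaf => Leaf
  | Node l r =>
    if k < leaves l then Node (prune k l) r else Node l (prune (k - leaves l) r)
  end.

Lemma prune_Node k l r : (l, r) <> (Leaf, Leaf) ->
  prune k (Node l r) =
    if k < leaves l then Node (prune k l) r else Node l (prune (k - leaves l) r).
Proof. by case: l r => [|? ?] [|? ?]. Qed.

Lemma graft_neq_Leaf k t : graft k t <> Leaf.
Proof. by case: t => //= l r; case: ifP. Qed.

Lemma carets_graft k t : carets (graft k t) = (carets t).+1.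
Proof.
by elim: t k => //= l IHl r IHr k; case: ifP => _ /=; rewrite ?IHl ?IHr ?addnS.
Qed.

Lemma leaves_graft k t : leaves (graft k t) = (leaves t).+1.
Proof. by rewrite !leavesE carets_graft. Qed.

Lemma graftK k t : k < leaves t -> prune k (graft k t) = t.
Proof.
elim: t k => //= l IHl r IHr k lt_k; case: ifP => lt_kl; rewrite prune_Node.
- by rewrite leaves_graft ltnS ltnW // IHl.
- by case=> /graft_neq_Leaf.
- by rewrite lt_kl IHr //; lia.
- by case=> _ /graft_neq_Leaf.
Qed.

Lemma pruneK k t : is_exposed t k -> graft k (prune k t) = t.
Proof.
elim: t k => // l IHl r IHr k.
have [[-> ->] //|ne] := both_LeafP l r.
rewrite is_exposed_NodeE // prune_Node // => /orP [ex|/andP [le ex]].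
  have lt := is_exposed_ltn ex; rewrite (ltnW lt) /=.
  have /(congr1 leaves) := IHl _ ex; rewrite leaves_graft => e.
  by rewrite IHl // ifT //; lia.
by rewrite ltnNge le /= ltnNge le /= IHr.
Qed.

Lemma exposed_graft k t : k < leaves t -> is_exposed (graft k t) k.
Proof.
elim: t k => [|l IHl r IHr] k /=; first by case: k.
move=> lt_k; case: ifP => lt_kl; rewrite is_exposed_NodeE.
- by rewrite IHl.
- by case=> /graft_neq_Leaf.
- by rewrite IHr; lia.
- by case=> _ /graft_neq_Leaf.
Qed.

(** Replacing leaf [k] by a caret can destroy an exposed caret at [k - 1] or
[k], and renumbers those further right; those further left are unaffected. *)
Lemma is_exposed_graft k t j : k < leaves t -> j.+1 < k ->
  is_exposed (graft k t) j = is_exposed t j.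
Proof.
elim: t k j => [|l IHl r IHr] k j; first by case: k.
rewrite [leaves _]/= [graft _ _]/= => lt_k lt_j.
case: ifP => lt_kl; rewrite is_exposed_NodeE.
- rewrite is_exposed_NodeE; last by case=> e; move: lt_kl; rewrite e /=; lia.
  by rewrite IHl // leaves_graft; congr (_ || _); lia.
- by case=> /graft_neq_Leaf.
- have [[el er]|ne] := both_LeafP l r.
    by move: lt_kl lt_k lt_j; rewrite el er /=; lia.
  rewrite is_exposed_NodeE //.
  congr (_ || _); case: leqP => //= le_lj; apply: IHr; lia.
- by case=> _ /graft_neq_Leaf.
Qed.

(** * Counting pairs without common exposed carets *)

Lemma leaves_ntree n (t : ntree n) : leaves t = n.+1.
Proof. by rewrite leavesE (eqP (valP t)). Qed.

Lemma carets_graft_ntree k n (t : ntree n) : carets (graft k t) == n.+1.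
Proof. by rewrite carets_graft (eqP (valP t)). Qed.

Definition graft_ntree k n (t : ntree n) : ntree n.+1 :=
  NTree (carets_graft_ntree k t).

Lemma graft_ntree_inj k n : k <= n -> injective (@graft_ntree k n).
Proof.
move=> le_kn t u /(congr1 (fun v => prune k (tree_of v))) /=.
by rewrite !graftK ?leaves_ntree // => /val_inj.
Qed.

Lemma graft_ntreeP k n (t : ntree n.+1) :
  is_exposed t k -> exists u : ntree n, graft_ntree k u = t.
Proof.
move=> ex; have : carets (prune k t) == n.
  by rewrite -eqSS -(carets_graft k) (pruneK ex) (valP t).
by move=> cp; exists (NTree cp); apply: val_inj; rewrite /= pruneK.
Qed.

Definition common_exposed n (p : tree_pair n) j : bool :=
  is_exposed p.1 j && is_exposed p.2 j.

(** Restricting to positions below [k] allows the pairs without any common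
exposed caret to be counted one position at a time. *)
Definition no_common_below n k : {set tree_pair n} :=
  [set p | [forall j : 'I_k, ~~ common_exposed p j]].

Lemma no_common_belowP n k (p : tree_pair n) :
  reflect (forall j, j < k -> ~~ common_exposed p j) (p \in no_common_below n k).
Proof.
rewrite inE; apply: (iffP forallP) => [H j lt_j|H j]; last exact: H.
exact: (H (Ordinal lt_j)).
Qed.

Lemma no_common_belowS n k (p : tree_pair n) :
  (p \in no_common_below n k.+1) = (p \in no_common_below n k) && ~~ common_exposed p k.
Proof.
apply/no_common_belowP/andP => [H|[/no_common_belowP H ck] j].
  by split; [apply/no_common_belowP => j lt_j; apply: H; lia | apply: H].
by rewrite ltnS leq_eqVlt => /orP [/eqP -> //|/H].
Qed.

(** Inclusion-exclusion, one position at a time. A pair counted on the left and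
not by the first term on the right has a common exposed caret at [k]; pruning it
from both trees yields a pair with one caret less. The bound drops to [k.-1]
because position [k - 1] cannot be exposed next to [k], so that after the pruning
nothing is required there. *)
Lemma card_no_common_belowS n k : k <= n ->
  #|no_common_below n.+1 k| = #|no_common_below n.+1 k.+1| + #|no_common_below n k.-1|.
Proof.
move=> le_kn; rewrite -(cardsID [set p | common_exposed p k]) addnC; congr (_ + _).
  by apply: eq_card => p; rewrite no_common_belowS !inE andbC.
pose f (p : tree_pair n) : tree_pair n.+1 :=
  (graft_ntree k p.1, graft_ntree k p.2).
have f_inj : injective f.
  move=> p q e; rewrite [p]surjective_pairing [q]surjective_pairing.
  congr (_, _); apply: (graft_ntree_inj le_kn).
    exact: (congr1 fst e).
  exact: (congr1 snd e).
rewrite -(card_imset _ f_inj); apply: eq_card => p.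
have common_f q j : j.+1 < k -> common_exposed (f q) j = common_exposed q j.
  by move=> lt_j; rewrite /common_exposed /= !is_exposed_graft ?leaves_ntree.
apply/setIP/imsetP => [[/no_common_belowP nc]|[q /no_common_belowP nc ->]].
  rewrite inE => /andP [/graft_ntreeP [u eu] /graft_ntreeP [v ev]].
  exists (u, v); last by rewrite /f eu ev; case: (p).
  apply/no_common_belowP => j lt_j; rewrite -common_f; last by lia.
  by rewrite /f eu ev /=; case: (p) nc => ? ? nc; apply: nc; lia.
split; last by rewrite inE /common_exposed /= !exposed_graft ?leaves_ntree.
apply/no_common_belowP => j lt_j; have [lt|] := ltnP j.+1 k.
  by rewrite common_f //; apply: nc; lia.
move=> le; have ek : k = j.+1 by lia.
apply/negP => /andP [/is_exposed_succ + _] /=.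
by rewrite -ek exposed_graft ?leaves_ntree.
Qed.

Lemma num_reduced_no_common n : 1 < n -> num_reduced n = #|no_common_below n n|.
Proof.
case: n => // n; rewrite ltnS => n_gt0; apply: eq_card => p.
rewrite inE /reduced /unreduced ltnS n_gt0 /=.
apply/hasPn/no_common_belowP => [H j _|H j ex1].
  rewrite /common_exposed; apply/nandP.
  by have := H j; rewrite !mem_exposed; case: is_exposed; auto.
have := H j; rewrite mem_exposed in ex1; rewrite mem_exposed /common_exposed ex1 /=.
by apply; have := is_exposed_ltn ex1; rewrite leaves_ntree; lia.
Qed.

Definition catalan n : nat := #|{: ntree n}|.

Lemma card_no_common_below0 n : #|no_common_below n 0| = catalan n ^ 2.
Proof.
rewrite -mulnn -card_prod; apply: eq_card => p.
by rewrite !inE; apply/forallP => - [].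
Qed.

Lemma catalan0 : catalan 0 = 1.
Proof.
apply: (eq_card1 (x := NTree (eqxx _ : carets Leaf == 0))) => t.
by rewrite !inE; apply/esym/eqP/val_inj; case: t => -[].
Qed.

(** Splitting at the root. *)
Lemma catalanS n : catalan n.+1 = \sum_(i < n.+1) catalan i * catalan (n - i).
Proof.
rewrite /catalan -sum1_card.
pose h (t : ntree n.+1) : 'I_n.+1 :=
  if tree_of t is Node l _ then inord (carets l) else ord0.
rewrite (partition_big h xpredT) //=; apply: eq_bigr => i _.
rewrite sum1dep_card -card_prod.
have nodeP (p : ntree i * ntree (n - i)) :
    carets (Node (tree_of p.1) (tree_of p.2)) == n.+1.
  rewrite /= (eqP (valP p.1)) (eqP (valP p.2)) subnKC //.
  by rewrite -ltnS.
pose f p := NTree (nodeP p).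
have f_inj : injective f.
  by move=> [a b] [c d] /(congr1 (@tree_of _)) [/val_inj -> /val_inj ->].
rewrite -(card_imset _ f_inj); apply: eq_card => t; rewrite inE.
apply/eqP/imsetP => [|[p _ ->]]; last first.
  by apply: val_inj; rewrite /h /= (eqP (valP p.1)) inordK.
case: t => -[|l r] //= ct /(congr1 (@nat_of_ord _)).
have lel : carets l < n.+1 by move: ct => /eqP [<-]; rewrite ltnS leq_addr.
rewrite /h /= inordK // => el.
have cl : carets l == i by rewrite el.
have cr : carets r == n - i by rewrite -el; move: ct => /eqP [<-]; rewrite addKn.
by exists (NTree cl, NTree cr) => //; apply: val_inj.
Qed.

(** * Power series modulo powers of the variable *)

Local Open Scope ring_scope.

Definition trunc (R : nzRingType) (f : nat -> R) (N : nat) : {poly R} :=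
  \poly_(i < N) f i.

Lemma coef_trunc (R : nzRingType) (f : nat -> R) N n :
  (n < N)%N -> (trunc f N)`_n = f n.
Proof. by rewrite coef_poly => ->. Qed.

Section Congruence.
Variable K : fieldType.
Implicit Types (p q r s : {poly K}) (N n : nat).

Definition congX N p q : bool := 'X^N %| p - q.

Lemma dvdXnP N p : reflect (forall n, (n < N)%N -> p`_n = 0) ('X^N %| p).
Proof.
apply: (iffP idP) => [/dvdpP [q ->] n lt_n|H]; first by rewrite coefMXn lt_n.
rewrite -[p](poly_take_drop N); set t := take_poly N p.
suff -> : t = 0 by rewrite add0r dvdp_mull.
by apply/polyP => n; rewrite coef_take_poly coef0; case: ifP => // /H.
Qed.

Lemma congXP N p q : reflect (forall n, (n < N)%N -> p`_n = q`_n) (congX N p q).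
Proof.
apply: (iffP (dvdXnP _ _)) => H n /H; rewrite coefB => /eqP.
  by rewrite subr_eq0 => /eqP.
by move=> /eqP ->; rewrite subrr.
Qed.

Lemma congX_refl N p : congX N p p.
Proof. by rewrite /congX subrr dvdp0. Qed.

Lemma congX_sym N p q : congX N p q -> congX N q p.
Proof. by rewrite /congX -opprB dvdpNr. Qed.

Lemma congX_trans N q p r : congX N p q -> congX N q r -> congX N p r.
Proof. by rewrite /congX => pq qr; rewrite -(subrKA q) dvdp_add. Qed.

Lemma congXD N p q r s : congX N p q -> congX N r s -> congX N (p + r) (q + s).
Proof. by rewrite /congX => pq rs; rewrite opprD addrACA dvdp_add. Qed.

Lemma congXM N p q r s : congX N p q -> congX N r s -> congX N (p * r) (q * s).
Proof.
rewrite /congX => pq rs; have -> : p * r - q * s = (p - q) * r + q * (r - s) by ring.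
by apply: dvdp_add; [apply: dvdp_mulr | apply: dvdp_mull].
Qed.

Lemma congXMl N r p q : congX N p q -> congX N (r * p) (r * q).
Proof. by move=> pq; apply: congXM => //; apply: congX_refl. Qed.

Lemma congX_exp N p q n : congX N p q -> congX N (p ^+ n) (q ^+ n).
Proof.
move=> pq; elim: n => [|n IH]; first exact: congX_refl.
by rewrite !exprS congXM.
Qed.

Lemma congX_comp N p q r : 'X %| r -> congX N p q -> congX N (p \Po r) (q \Po r).
Proof.
rewrite /congX -comp_polyB => Xr /dvdpP [s ->].
by rewrite comp_polyM comp_Xn_poly dvdp_mull // dvdp_exp2r.
Qed.

Lemma coprimepXn N p : p.[0] != 0 -> coprimep 'X^N p.
Proof.
by move=> p0; rewrite coprimep_expl // -['X]subr0 -polyC0 coprimep_sym coprimep_XsubC.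
Qed.

Lemma congX_mulI N r p q : r.[0] != 0 -> congX N (r * p) (r * q) -> congX N p q.
Proof. by move=> r0; rewrite /congX -mulrBr Gauss_dvdpr // coprimepXn. Qed.

(** Uniqueness of square roots, as [p ^+ 2 - q ^+ 2] factors and the factor [p + q]
is invertible modulo ['X^N]. *)
Lemma congX_sqr N p q : p.[0] + q.[0] != 0 -> congX N (p ^+ 2) (q ^+ 2) -> congX N p q.
Proof.
move=> pq0; rewrite /congX subr_sqr mulrC Gauss_dvdpr //.
by rewrite coprimepXn // hornerD.
Qed.

Lemma congX_eq0 p : (forall N, 'X^N %| p) -> p = 0.
Proof. by move=> H; apply/polyP => n; rewrite (dvdXnP _ _ (H n.+1)) ?coef0. Qed.

End Congruence.

(** * The generating function of reduced pairs *)

Section GeneratingFunctions.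
Variable K : fieldType.
Implicit Types (N n : nat).

(** The recurrence [card_no_common_belowS] solved: the binomial coefficient counts
the sets of [j] pairwise non-adjacent positions below [k], and its recurrence is
Pascal's rule. *)
Lemma card_no_common_below n k : (k <= n)%N ->
  #|no_common_below n k|%:R = \sum_(j < n.+1)
    (-1) ^+ j * 'C(k.+1 - j, j)%:R * (catalan (n - j))%:R ^+ 2 :> K.
Proof.
elim/ltn_ind: k n => -[|k] IH [|n] // le_kn.
- by rewrite card_no_common_below0 big_ord_recl big_ord0 expr0 !mul1r natrX addr0.
- rewrite card_no_common_below0 big_ord_recl big1 ?addr0 => [|j _].
    by rewrite expr0 !mul1r natrX.
  by rewrite lift0 subSS sub0n bin0n mulr0 mul0r.
have := @card_no_common_belowS n k le_kn => /(congr1 (fun i => i%:R : K)) /eqP.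
rewrite natrD -subr_eq => /eqP <-; rewrite IH //; last exact: ltnW.
rewrite IH; [|by case: (k)|by case: (k) le_kn => //= ?; lia].
rewrite big_ord_recl [RHS]big_ord_recl -addrA !subn0 !bin0; congr (_ + _).
rewrite -sumrB; apply: eq_bigr => j _; rewrite lift0 !subSS.
rewrite -mulrBl; congr (_ * _).
have -> : 'C(k.-1.+1 - j, j) = 'C(k - j, j).
  by case: (k) => // ; case: (nat_of_ord j).
have [le_jk|lt_kj] := leqP j k; last first.
  have -> : (k.+1 - j = 0)%N by lia.
  have -> : (k - j = 0)%N by lia.
  by case: (nat_of_ord j) lt_kj => // i _; rewrite !bin0n !mulr0 subr0.
by rewrite subSn // binS natrD exprS; ring.
Qed.

Lemma coef_1subX m j : ((1 - 'X) ^+ m : {poly K})`_j = (-1) ^+ j * 'C(m, j)%:R.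
Proof.
elim: m j => [|m IH] j.
  by rewrite expr0 coef1; case: j => [|j]; rewrite /= ?mulr1 ?mulr0.
rewrite exprSr mulrBr mulr1 coefB coefMX IH; case: j => [|j] /=.
  by rewrite !bin0 subr0.
by rewrite IH binS natrD exprS; ring.
Qed.

(** The formula for [k = n], corrected for the two conventions that the empty
pair is not counted and that the pair of single carets counts as reduced. *)
Lemma num_reducedE n : (num_reduced n)%:R =
  \sum_(j < n.+1) (-1) ^+ j * 'C(n.+1 - j, j)%:R * (catalan (n - j))%:R ^+ 2
    - (n == 0)%:R + (n == 1)%:R :> K.
Proof.
case: n => [|[|n]].
- rewrite big_ord_recl big_ord0 /= !subn0 catalan0 bin0; ring.
- have -> : num_reduced 1 = (catalan 1 ^ 2)%N.
    by rewrite -card_no_common_below0; apply: eq_card => p; rewrite !inE; apply/esym/forallP => -[].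
  rewrite big_ord_recl big_ord_recl big_ord0 /= !subn0 subnn catalan0 bin0.
  by rewrite natrX bin1 -[bump 0 0]/1%N subn1 /=; ring.
by rewrite num_reduced_no_common // card_no_common_below // subr0 addr0.
Qed.

Definition catalan_sqr n : K := (catalan n)%:R ^+ 2.
(** The substitution of [z(1 - z)] for [z], inverse to that of [zC(z)], which
hangs an arbitrary tree from every leaf. *)
Definition logistic : {poly K} := 'X * (1 - 'X).

Lemma coef_comp_logistic (f : nat -> K) N n : (n < N)%N ->
  ((1 - 'X) * (trunc f N \Po logistic))`_n =
   \sum_(j < n.+1) (-1) ^+ j * 'C(n.+1 - j, j)%:R * f (n - j)%N.
Proof.
move=> lt_nN; rewrite /trunc poly_def raddf_sum /= mulr_sumr coef_sum.
transitivity (\sum_(m < n.+1) f m * ((-1) ^+ (n - m) * 'C(m.+1, n - m)%:R)).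
  rewrite (big_ord_widen N (fun m => f m * ((-1) ^+ (n - m) * 'C(m.+1, n - m)%:R))) //.
  rewrite [RHS]big_mkcond; apply: eq_bigr => m _.
  rewrite comp_polyZ comp_Xn_poly -scalerAr coefZ exprMn mulrCA -exprS coefXnM.
  by rewrite coef_1subX ltnS ltnNge; case: (m <= n)%N => //=; rewrite mulr0.
rewrite (reindex_inj rev_ord_inj); apply: eq_bigr => j _ /=.
have le_jn : (j <= n)%N by rewrite -ltnS.
by rewrite subSS subKn // mulrC subSn.
Qed.

Lemma num_reduced_congX N :
  congX N (trunc (fun n => (num_reduced n)%:R) N)
    ((1 - 'X) * (trunc catalan_sqr N \Po logistic) - (1 - 'X)).
Proof.
apply/congXP => n lt_n; rewrite coef_trunc // coefB coef_comp_logistic // num_reducedE.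
rewrite coefB coef1 coefX; ring.
Qed.

(** The coefficients of [1 - 2zC(z)]. *)
Definition sqrt_coef n : K := if n is m.+1 then - 2 * (catalan m)%:R else 1.

(** The equation [C = 1 + zC^2], that is [catalanS], with the square completed. *)
Lemma sqrt_coef_sqr N :
  congX N (trunc sqrt_coef N ^+ 2) (1 - 4 *: 'X).
Proof.
apply/congXP => -[|[|n]] lt_n; rewrite expr2 coefM.
- by rewrite big_ord_recl big_ord0 !coef_trunc // coefB coefZ coef1 coefX /=; ring.
- rewrite big_ord_recl big_ord_recl big_ord0 !coef_trunc ?(ltnW lt_n) //=.
  by rewrite coefB coefZ coef1 coefX catalan0 /=; ring.
rewrite big_ord_recl big_ord_recr /= !coef_trunc ?subnn //; try lia.
rewrite coefB coefZ coef1 coefX /= mulr0 subrr.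
have -> : \sum_(i < n.+1) (trunc sqrt_coef N)`_(bump 0 i) *
    (trunc sqrt_coef N)`_(n.+2 - bump 0 i) = 4 * (catalan n.+1)%:R.
  rewrite catalanS natr_sum mulr_sumr; apply: eq_bigr => i _.
  have le_in : (i <= n)%N by rewrite -ltnS.
  rewrite /bump add1n subSS subSn // !coef_trunc; try lia.
  by rewrite /= natrM; ring.
by rewrite /bump /=; ring.
Qed.

(** The Hadamard square of the square root of [1 - 4z] is [1 + 4zP], and
[4w (P(w) - 1)] is [4z] times [(1 - z)(P(w) - 1)]. *)
Lemma num_reduced_sqrt N :
  congX N (4 *: 'X * trunc (fun n => (num_reduced n)%:R) N + (1 + 4 *: logistic))
    (trunc (fun n => sqrt_coef n ^+ 2) N \Po logistic).
Proof.
have step : congX N (4 *: 'X * trunc catalan_sqr N + 1)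
    (trunc (fun n => sqrt_coef n ^+ 2) N).
  apply/congXP => -[|n] lt_n; rewrite coefD coef1 -scalerAl coefZ coefXM [RHS]coef_trunc //=.
    by rewrite mulr0 add0r expr1n.
  by rewrite coef_trunc ?(ltnW lt_n) // /catalan_sqr; ring.
have Xw : 'X %| logistic by rewrite dvdp_mulr.
apply: congX_trans (congX_comp Xw step).
have := congXMl (4 *: 'X) (num_reduced_congX N).
move=> /congXD /(_ (congX_refl N (1 + 4 *: logistic))) /congX_trans; apply.
have -> : (4 *: 'X * trunc catalan_sqr N + 1) \Po logistic =
  4 *: 'X * ((1 - 'X) * (trunc catalan_sqr N \Po logistic) - (1 - 'X)) + (1 + 4 *: logistic).
  rewrite comp_polyD comp_polyM comp_polyZ comp_polyX -polyC1 comp_polyC.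
  by rewrite /logistic -!mul_polyC; ring.
exact: congX_refl.
Qed.
End GeneratingFunctions.

(** * Frobenius and algebraic equations *)

Section Frobenius.
Variables (K : fieldType) (p : nat).
Hypothesis charK : p \in [pchar K].
Implicit Types (q e V : {poly K}).

Let p_gt0 : (0 < p)%N. Proof. exact: prime_gt0 (pcharf_prime charK). Qed.

Lemma frobD (x y : {poly K}) : (x + y) ^+ p = x ^+ p + y ^+ p.
Proof.
by rewrite exprDn_pchar // pnatE ?(pcharf_prime charK) // pchar_poly.
Qed.

Lemma frob_sum I (r : seq I) (F : I -> {poly K}) :
  (\sum_(i <- r) F i) ^+ p = \sum_(i <- r) F i ^+ p.
Proof. by apply: (big_morph (fun x => x ^+ p) frobD); rewrite expr0n gtn_eqF. Qed.

(** As [q ^+ p] is a polynomial in ['X^p], the only contribution to the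
coefficient of index [n] comes from the remainder and the quotient of [n]. *)
Lemma coef_mul_frob e q n : (forall x : K, x ^+ p = x) -> (size e <= p)%N ->
  (e * q ^+ p)`_n = e`_(n %% p) * q`_(n %/ p).
Proof.
move=> frobK le_ep; elim/poly_ind: q n => [|q c IH] n.
  by rewrite expr0n (gtn_eqF p_gt0) mulr0 !coef0 mulr0.
rewrite frobD exprMn -polyC_exp frobK mulrDr mulrA coefD coefMXn coefMC.
rewrite coefD coefMX coefC; case: ltnP => [lt_np|le_pn].
  by rewrite divn_small // modn_small // !eqxx; ring.
rewrite [e`_n]nth_default ?(leq_trans le_ep) // mul0r addr0 IH.
have -> : (n = (n - p) + p)%N by rewrite subnK.
by rewrite modnDr divnDr ?dvdnn // divnn p_gt0 addn1 addnK /= addr0.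
Qed.

(** Raising the equation [Q] to the power [p] and using [T = V T^p] gives an
equation [Q1] with the same support. A combination of the two cancels the
leading terms: either it is an equation of smaller size, or the two equations
are proportional, and then comparing two coefficients gives the claim. The
second coefficient exists because an equation with a single term is excluded by
[T] being invertible. *)
Lemma frobenius_relation V (T : nat -> {poly K}) (Q : {poly {poly K}}) :
  V != 0 -> Q != 0 ->
  (forall N, coprimep 'X^N (T N)) ->
  (forall N, congX N (T N) (V * T N ^+ p)) ->
  (forall N, 'X^N %| Q.[T N]) ->
  exists (m : nat) (a b : {poly K}),
    [/\ (0 < m < size Q)%N, a != 0 & V ^+ m * a ^+ p.-1 = b ^+ p.-1].
Proof.
move=> V0 + coT VT; have [n le_n] := ubnP (size Q).
elim: n => // n IH in Q le_n * => Q0 QT.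
pose c := lead_coef Q; pose d := (size Q).-1.
have c0 : c != 0 by rewrite lead_coef_eq0.
have sQ : size Q = d.+1 by rewrite prednK // size_poly_gt0.
pose Q1 : {poly {poly K}} := \poly_(j < d.+1) (Q`_j ^+ p * V ^+ (d - j)).
have Q1T N : 'X^N %| Q1.[T N].
  have : congX N (V ^+ d * Q.[T N] ^+ p) Q1.[T N].
    rewrite horner_coef sQ horner_poly frob_sum mulr_sumr /congX -sumrB.
    apply: (big_ind (fun x => 'X^N %| x)) => [|x y|i _]; [exact: dvdp0 | exact: dvdp_add|].
    have -> : V ^+ d * (Q`_i * T N ^+ i) ^+ p - Q`_i ^+ p * V ^+ (d - i) * T N ^+ i =
       Q`_i ^+ p * V ^+ (d - i) * ((V * T N ^+ p) ^+ i - T N ^+ i).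
      have {1}-> : (d = (d - i) + i)%N by rewrite subnK // -ltnS.
      by rewrite exprD !exprMn -!exprM [(i * p)%N]mulnC; ring.
    by apply/dvdp_mull/congX_exp/congX_sym.
  rewrite /congX dvdp_subr // dvdp_mull //.
  by rewrite dvdp_exp.
pose Q2 := c *: Q1 - c ^+ p *: Q.
have Q2T N : 'X^N %| Q2.[T N].
  by rewrite /Q2 hornerD hornerN !hornerZ dvdp_sub // dvdp_mull.
have coefQ2 j : (j <= d)%N -> Q2`_j = c * (Q`_j ^+ p * V ^+ (d - j)) - c ^+ p * Q`_j.
  by move=> le_j; rewrite coefB !coefZ coef_poly ltnS le_j.
have sQ2 : (size Q2 <= d)%N.
  apply/leq_sizeP => j; rewrite leq_eqVlt => /orP [/eqP <-|lt_j].
    by rewrite coefQ2 // subnn -/c; rewrite /d -lead_coefE -/c; ring.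
  by rewrite coefB !coefZ coef_poly ltnS leqNgt lt_j nth_default ?sQ //; ring.
(* Either descend to the smaller equation Q2, or Q and Q1 are proportional. *)
have [Q20|Q2n0] := eqVneq Q2 0; last first.
  have [|e [a [b [/andP [e0 le] a0 E]]]] := IH Q2 _ Q2n0 Q2T.
    by rewrite -ltnS (leq_trans _ le_n) // sQ ltnS ltnS.
  by exists e, a, b; split => //; rewrite e0 sQ ltnS ltnW // (leq_trans le).
have [/existsP [j Qj]|/existsPn Qj] := boolP [exists j : 'I_d, Q`_j != 0].
  exists (d - j)%N, Q`_j, c; split=> //; first by rewrite sQ subn_gt0 ltn_ord ltnS leq_subr.
  have := coefQ2 j (ltnW (ltn_ord j)); rewrite Q20 coef0 => /esym/eqP.
  rewrite subr_eq0 -(prednK p_gt0) !exprS => /eqP E.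
  apply: (mulfI (mulf_neq0 c0 Qj)); move: E => /=.
  by rewrite -[RHS]mulrA [_ * Q`_j]mulrC !mulrA => <-; ring.
(* Otherwise Q is the single term c Y^d. *)
suff /eqP : c = 0 by rewrite (negPf c0).
apply: congX_eq0 => N.
rewrite -(Gauss_dvdpl _ (_ : coprimep 'X^N (T N ^+ d))); last by rewrite coprimep_expr.
have := QT N; rewrite horner_coef sQ big_ord_recr /= big1 ?add0r //.
by move=> i _; have /negPn/eqP -> := Qj i; rewrite mul0r.
Qed.

End Frobenius.

(** * The Hasse polynomial has simple roots *)

Section Separability.
Variables (L : fieldType) (p : nat).
Hypothesis charL : p \in [pchar L].
Implicit Types (B q : {poly L}).

(** The Picard-Fuchs equation of the Legendre family in the parameter [16z], with
the solution sum_n binomial(2n, n)^2 z^n. *)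
Definition legendre_ode B : {poly L} :=
  'X * (1 - 16 *: 'X) * B^`()^`() + (1 - 32 *: 'X) * B^`() - 4 *: B.

Lemma natf_lt_char n : (0 < n < p)%N -> n%:R != 0 :> L.
Proof.
move=> /andP [n0 lt_n]; rewrite -(dvdn_pcharf charL).
by apply/negP => /(dvdn_leq n0); rewrite leqNgt lt_n.
Qed.

(** The order of vanishing [m] at a root [a] is a root of the indicial equation
modulo [p]. That is [m (m - 1) = 0] at a regular point and [m ^+ 2 = 0] at the
singular point [1/16]; as [m < p], the first leaves a simple root and the second
no root at all. *)
Lemma legendre_simple_root B a : legendre_ode B = 0 -> B.[0] != 0 ->
  (size B <= p)%N -> root B a -> ~~ root B^`() a.
Proof.
move=> ode B0 sB Ba; apply/negP => dBa.
have nzB : B != 0 by apply: contraNneq B0 => ->; rewrite horner0.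
have [m [q]] := multiplicity_XsubC B a; rewrite nzB /= => qa EB.
have a0 : a != 0 by apply: contraNneq B0 => e; rewrite -rootE; move: Ba; rewrite e.
have [k Ek] : exists k, m = k.+2.
  case: m EB => [|[|k]] EB; last by exists k.
    by move: Ba; rewrite EB expr0 mulr1 (negPf qa).
  move: dBa; rewrite EB expr1 derivM derivXsubC rootE hornerD !hornerM.
  by rewrite hornerXsubC subrr hornerC mulr0 add0r mulr1 -rootE (negPf qa).
set u := 'X - a%:P in EB.
have nzu : u != 0 by rewrite polyXsubC_eq0.
have nzq : q != 0 by apply: contraNneq qa => ->; rewrite root0.
have lt_mp : (m < p)%N.
  apply: leq_trans sB; rewrite EB size_Mmonic ?monic_exp ?monicXsubC //.
  by rewrite size_exp_XsubC addnS /= -{1}[m]add0n ltn_add2r size_poly_gt0.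
pose c : L := k.+2%:R; pose d : L := k.+1%:R.
have m0 : c != 0 by apply: natf_lt_char; rewrite -Ek lt_mp Ek.
have m1 : d != 0 by apply/natf_lt_char/andP; split=> //; apply: ltnW; rewrite -Ek.
have du : u^`() = 1 by rewrite derivXsubC.
have cE : c%:P = k.+2%:R :> {poly L} by exact: rmorph_nat.
have dE : d%:P = k.+1%:R :> {poly L} by exact: rmorph_nat.
have cd : c = d + 1 by rewrite /c /d -natr1.
have dB : B^`() = u ^+ k.+1 * (q^`() * u + c%:P * q).
  by rewrite EB Ek derivM deriv_exp derivXsubC mul1r exprS /= cE; ring.
have ddB : B^`()^`() = u ^+ k * (q^`()^`() * u ^+ 2 + (2 * c)%:P * (q^`() * u)
              + (c * d)%:P * q).
  rewrite dB derivM deriv_exp du derivD !derivM derivC du mul1r mulr1 exprS /=.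
  by rewrite -[_ *+ k.+1]mulr_natl -dE cd; ring.
have ua : u.[a] = 0 by rewrite hornerXsubC subrr.
have Xu : 'X = u + a%:P by rewrite subrK.
clearbody u c d.
have {}ode : 'X * (1 - 16 *: 'X) * (q^`()^`() * u ^+ 2 + (2 * c)%:P * (q^`() * u)
              + (c * d)%:P * q) + (1 - 32 *: 'X) * u * (q^`() * u + c%:P * q)
              - 4 *: (q * u ^+ 2) = 0.
  apply: (mulfI (expf_neq0 k nzu)); rewrite mulr0 -ode /legendre_ode ddB dB EB Ek.
  by rewrite !exprS -!mul_polyC; ring.
have hE := (hornerD, hornerN, hornerM, hornerZ, hornerX, hornerC, horner_exp).
(* The term of order m - 2 vanishes, so a must be a singular point. *)
have a16 : 16 * a = 1.
  have : (_).[a] = 0.[a] := congr1 (horner^~ a) ode.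
  rewrite !hE ua => E.
  have {E} : a * (1 - 16 * a) * (q.[a] * c * d) = 0 by rewrite -E; ring.
  move/eqP; rewrite !mulf_eq0 (negPf a0) (negPf m0) (negPf m1) -rootE (negPf qa).
  by rewrite !orbF subr_eq0 => /eqP.
(* At the singular point one more factor u cancels; evaluating the rest at a
   gives the indicial equation. *)
have X16 : 1 - 16 *: 'X = - 16 *: u.
  have e : 16%:P * a%:P = 1 :> {poly L} by rewrite -polyCM a16.
  by rewrite Xu -!mul_polyC -e polyCN; ring.
have {}ode : 'X * (- 16)%:P * (q^`()^`() * u ^+ 2 + (2 * c)%:P * (q^`() * u)
              + (c * d)%:P * q) + (1 - 32 *: 'X) * (q^`() * u + c%:P * q)
              - 4 *: (q * u) = 0.
  apply: (mulfI nzu); rewrite mulr0 -ode X16.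
  by rewrite -!mul_polyC; ring.
have : (_).[a] = 0.[a] := congr1 (horner^~ a) ode.
rewrite !hE ua => E.
have {E} : q.[a] * c * c = 0.
  have -> : q.[a] * c * c = (16 * a) * (q.[a] * c * c) by rewrite a16 mul1r.
  have -> : 16 * a * (q.[a] * c * c) =
    - (a * -16 * (c * d * q.[a]) + (16 * a - 32 * a) * (c * q.[a])).
    by rewrite cd; ring.
  by rewrite a16 -[RHS]oppr0 -E; ring.
by move/eqP; rewrite !mulf_eq0 (negPf m0) -rootE (negPf qa).
Qed.
End Separability.

(** A common factor would have a root in an algebraic closure. *)
Lemma legendre_ode_coprime (K : countFieldType) (p : nat) (B : {poly K}) :
  p \in [pchar K] -> legendre_ode B = 0 -> B.[0] != 0 -> (size B <= p)%N ->
  coprimep B B^`().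
Proof.
move=> charK ode B0 sB; have [L [f _]] := countable_algebraic_closure K.
rewrite -(coprimep_map f) -deriv_map; set C := map_poly f B.
have charL : p \in [pchar L] by rewrite (fmorph_pchar f).
have odeC : legendre_ode C = 0.
  rewrite -[RHS](rmorph0 (map_poly f)) -ode /legendre_ode /C.
  rewrite rmorphB rmorphD !rmorphM !rmorphB rmorph1 /=.
  by rewrite !map_polyZ !map_polyX -!deriv_map !rmorph_nat.
have C0 : C.[0] != 0 by rewrite -[X in C.[X]](rmorph0 f) horner_map fmorph_eq0.
rewrite /coprimep; apply/negPn/negP => /closed_rootP [a].
rewrite root_gcd => /andP [Ca]; apply/negP.
by apply: (legendre_simple_root charL odeC C0 _ Ca); rewrite size_map_poly.
Qed.

Section HadamardSquare.
Variables (K : fieldType) (p s : nat).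
Hypothesis charK : p \in [pchar K].
Hypothesis Ep : p = s.*2.+1.

Definition hadamard_sqr (q : {poly K}) : {poly K} := \poly_(i < size q) q`_i ^+ 2.

Lemma coef_hadamard_sqr q n : (hadamard_sqr q)`_n = q`_n ^+ 2.
Proof.
by rewrite coef_poly; case: ltnP => // le; rewrite nth_default // expr0n.
Qed.

Lemma size_hadamard_sqr q : size (hadamard_sqr q) = size q.
Proof.
have [->|q0] := eqVneq q 0.
  by rewrite /hadamard_sqr size_poly0 poly_def big_ord0 size_poly0.
have s0 : (0 < size q)%N by rewrite size_poly_gt0.
by rewrite size_poly_eq // expf_neq0 // -lead_coefE lead_coef_eq0.
Qed.

Definition catalan_disc : {poly K} := 1 - 4 *: 'X.

Lemma two_neq0 : 2 != 0 :> K.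
Proof.
apply: (natf_lt_char charK); have := prime_gt1 (pcharf_prime charK).
by rewrite Ep !ltnS double_gt0; case: (s).
Qed.

Lemma four_neq0 : 4 != 0 :> K.
Proof. by rewrite (natrM _ 2 2) mulf_neq0 // two_neq0. Qed.

Lemma size_catalan_discX n : size (catalan_disc ^+ n) = n.+1.
Proof.
have sy : size catalan_disc = 2.
  have -> : catalan_disc = - 4 *: ('X - (4^-1)%:P).
    rewrite scalerBr -!mul_polyC -polyCM mulNr divff ?four_neq0 //.
    by rewrite polyCN /catalan_disc -mul_polyC; ring.
  by rewrite size_scale ?size_XsubC // oppr_eq0 four_neq0.
have := size_exp catalan_disc n; rewrite sy mul1n => e.
by rewrite -[in RHS]e prednK // size_poly_gt0 expf_neq0 // -size_poly_gt0 sy.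
Qed.

(** With [p = 2s + 1], this is the truncation at [p] of
sum_n binomial(2n, n)^2 z^n modulo [p], the Hasse polynomial of the Legendre
family. *)
Definition hasse_poly : {poly K} := hadamard_sqr (catalan_disc ^+ s).

Lemma half_neg1 : s%:R *+ 2 = - 1 :> K.
Proof.
apply/eqP; rewrite -addr_eq0 -mulrnA muln2 -[X in _ + X]/(1%:R) -natrD addn1 -Ep.
exact/eqP/pcharf0.
Qed.

Lemma coefXderiv (q : {poly K}) n : ('X * q^`())`_n = q`_n *+ n.
Proof. by rewrite coefXM; case: n => [|n] //=; rewrite coef_deriv. Qed.

Lemma coef_catalan_discX b :
  (catalan_disc ^+ s)`_b.+1 *+ b.+1 = 4 * (b%:R - s%:R) * (catalan_disc ^+ s)`_b.
Proof.
have E : (catalan_disc ^+ s)^`() - 4 *: ('X * (catalan_disc ^+ s)^`()) =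
    - (4 * s%:R) *: catalan_disc ^+ s.
  have -> : (catalan_disc ^+ s)^`() - 4 *: ('X * (catalan_disc ^+ s)^`()) =
      catalan_disc * (catalan_disc ^+ s)^`().
    by rewrite /catalan_disc -!mul_polyC; ring.
  rewrite deriv_exp; case: (s) => [|k] /=.
    by rewrite !mulr0n !mulr0 oppr0 scale0r.
  have -> : catalan_disc^`() = - 4%:P.
    by rewrite /catalan_disc derivB derivZ derivX -polyC1 derivC sub0r -mul_polyC mulr1.
  by rewrite -mul_polyC !polyCN polyCM rmorph_nat exprS; ring.
have := congr1 (fun q : {poly K} => q`_b) E.
rewrite coefB !coefZ coefXderiv coef_deriv => /eqP.
by rewrite subr_eq => /eqP ->; rewrite -mulr_natr; ring.
Qed.

(** On coefficients the equation says (b+1)^2 x_(b+1) = 4 (2b+1)^2 x_b. This is the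
square of the recurrence of the coefficients of [(1 - 4z)^s], because [2s = -1]
modulo [p]. *)
Lemma hasse_ode : legendre_ode hasse_poly = 0.
Proof.
(* In terms of q |-> X q', which multiplies the coefficient of index n by n. *)
have -> : legendre_ode hasse_poly = ('X * hasse_poly^`())^`()
   - (16 *: ('X * ('X * hasse_poly^`())^`()) + 16 *: ('X * hasse_poly^`())
      + 4 *: hasse_poly).
  by rewrite /legendre_ode derivM derivX -!mul_polyC; ring.
apply/polyP => b; rewrite coef0 coefB !coefD !coefZ coef_deriv !coefXderiv.
rewrite !coef_hadamard_sqr.
have e1 : 1 + b%:R *+ 2 = b%:R *+ 2 - s%:R *+ 2 :> K by rewrite half_neg1 opprK addrC.
have E : ((catalan_disc ^+ s)`_b.+1 *+ b.+1) ^+ 2 =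
    4 * (1 + b%:R *+ 2) ^+ 2 * (catalan_disc ^+ s)`_b ^+ 2.
  by rewrite coef_catalan_discX e1; ring.
have -> : (catalan_disc ^+ s)`_b.+1 ^+ 2 *+ b.+1 *+ b.+1 =
    ((catalan_disc ^+ s)`_b.+1 *+ b.+1) ^+ 2 by ring.
by rewrite E; ring.
Qed.

Lemma hasse0 : hasse_poly.[0] != 0.
Proof.
rewrite horner_coef0 coef_hadamard_sqr -horner_coef0 !hornerE.
by rewrite subr0 !expr1n oner_neq0.
Qed.

Lemma size_hasse : size hasse_poly = s.+1.
Proof. by rewrite size_hadamard_sqr size_catalan_discX. Qed.

End HadamardSquare.

(** * Bounding the exponent of a power *)

(** Since polynomials over a field are integrally closed, [a] may be cancelled:
V^e = c^(p-1), where V = B(w), so V^e c is a p-th power and its derivative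
vanishes. This makes V divide V' c, hence (1 - 2z) c, and comparing degrees with
deg c = e bounds [p]. *)
Lemma kummer_degree_bound (K : fieldType) (p e : nat) (B a b : {poly K}) :
  p \in [pchar K] -> coprimep B B^`() -> (size (B \Po logistic K)).-1 = p.-1 ->
  (0 < e < p)%N -> a != 0 ->
  (B \Po logistic K) ^+ e * a ^+ p.-1 = b ^+ p.-1 -> (p <= e + 2)%N.
Proof.
move=> charK coB sB /andP [e_gt0 lt_ep] a0 E.
have p_gt1 := prime_gt1 (pcharf_prime charK).
have p1_gt0 : (0 < p.-1)%N by lia.
set V := B \Po logistic K in sB E.
have sV : (1 < size V)%N by lia.
have V0 : V != 0 by rewrite -size_poly_gt0; lia.
have : a ^+ p.-1 %| b ^+ p.-1 by rewrite -E dvdp_mull.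
rewrite dvdp_pexp2r // => /dvdpP [c Eb].
have {E} E : V ^+ e = c ^+ p.-1.
  by apply: (mulIf (expf_neq0 p.-1 a0)); rewrite E Eb exprMn.
have c0 : c != 0.
  apply: contraTneq isT => c0; move: E; rewrite c0 expr0n gtn_eqF //.
  by move/eqP; rewrite expf_eq0 (negPf V0) andbF.
have sc : (size c).-1 = e.
  apply/eqP; rewrite -(eqn_pmul2r p1_gt0) -size_exp -E size_exp sB.
  by rewrite mulnC.
have pK : p%:R = 0 :> {poly K} by apply/pcharf0; rewrite pchar_poly.
have dc : (V ^+ e * c)^`() = 0.
  by rewrite E -exprSr prednK ?(ltnW p_gt1) // deriv_exp -mulr_natr pK mulr0.
have {}dc : V * c^`() = - (e%:R *: (V^`() * c)).
  apply/eqP; rewrite -addr_eq0; apply/eqP.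
  apply: (mulfI (expf_neq0 e.-1 V0)); rewrite mulr0 -[RHS]dc.
  rewrite derivM deriv_exp scaler_nat.
  have -> : V ^+ e = V * V ^+ e.-1 by rewrite -exprS prednK.
  ring.
(* V' = (1 - 2z) B'(w), and B(w) is coprime to B'(w). *)
have Vc : V %| (1 - 2 *: 'X) * c.
  have e0 : e%:R != 0 :> K by rewrite (natf_lt_char charK) ?e_gt0.
  have : V %| V^`() * c.
    by rewrite -(dvdpZr _ _ e0) -dvdpNr -dc dvdp_mulr.
  rewrite /V deriv_comp -mulrA Gauss_dvdpr.
    suff -> : (logistic K)^`() = 1 - 2 *: 'X by [].
    by rewrite /logistic derivM derivX derivB derivX -polyC1 derivC -mul_polyC; ring.
  apply/Bezout_eq1_coprimepP; have /Bezout_eq1_coprimepP [[u v] /= uv] := coB.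
  exists (u \Po logistic K, v \Po logistic K) => /=.
  by rewrite -!comp_polyM -comp_polyD uv -polyC1 comp_polyC.
have s2 : (size (1 - 2 *: 'X : {poly K})%R <= 2)%N.
  apply: leq_trans (size_polyD _ _) _; rewrite geq_max size_poly1 size_polyN /=.
  by apply: leq_trans (size_scale_leq _ _) _; rewrite size_polyX.
have n0 : 1 - 2 *: 'X != 0 :> {poly K}.
  apply/negP => /eqP /(congr1 (fun q : {poly K} => q`_0)) /eqP.
  by rewrite coefB coefZ coefX coef1 mulr0 subr0 coef0 oner_eq0.
have := dvdp_leq (mulf_neq0 n0 c0) Vc; rewrite size_mul //.
have : (0 < size c)%N by rewrite size_poly_gt0.
have aux x y z : (x <= 2 -> y.-1 = e -> z.-1 = p.-1 -> 1 < z -> 1 < p ->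
  0 < y -> z <= (x + y).-1 -> p <= e + 2)%N by lia.
exact: aux s2 sc sB sV p_gt1.
Qed.

(** * Reduced pairs modulo an odd prime *)

Lemma congX_horner (K : fieldType) N (Q : {poly {poly K}}) u v :
  congX N u v -> congX N Q.[u] Q.[v].
Proof.
move=> uv; elim/poly_ind: Q => [|Q c IH]; first by rewrite !horner0 congX_refl.
by rewrite !hornerMXaddC congXD ?congXM // congX_refl.
Qed.

(** An equation of degree [d] for [r], multiplied by [c ^+ d], is an equation for
[c * r], into which the expression in [y] is substituted. *)
Lemma affine_relation (K : fieldType) (c a b : {poly K}) (r y : nat -> {poly K})
    (Q : {poly {poly K}}) :
  c != 0 -> a != 0 -> Q != 0 ->
  (forall N, congX N (c * r N) (a * y N + b)) ->
  (forall N, 'X^N %| Q.[r N]) ->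
  exists Q' : {poly {poly K}}, [/\ size Q' = size Q, Q' != 0 &
    forall N, 'X^N %| Q'.[y N]].
Proof.
move=> c0 a0 Q0 ry Qr; pose d := (size Q).-1.
have sQ : size Q = d.+1 by rewrite prednK // size_poly_gt0.
pose Qc : {poly {poly K}} := \poly_(i < d.+1) (Q`_i * c ^+ (d - i)).
have sQc : size Qc = size Q.
  by rewrite sQ size_poly_eq // subnn mulr1 -lead_coefE lead_coef_eq0.
have Qc0 : Qc != 0 by rewrite -size_poly_gt0 sQc size_poly_gt0.
have Qcr x : Qc.[c * x] = c ^+ d * Q.[x].
  rewrite horner_poly horner_coef sQ mulr_sumr; apply: eq_bigr => i _.
  have -> : c ^+ d = c ^+ (d - i) * c ^+ i by rewrite -exprD subnK // -ltnS.
  by rewrite exprMn; ring.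
have s2 : size (a *: 'X + b%:P) = 2.
  by rewrite size_polyDl size_scale // size_polyX // size_polyC; case: eqP.
exists (Qc \Po (a *: 'X + b%:P)); split; first by rewrite size_comp_poly2.
  by rewrite comp_poly2_eq0.
move=> N; rewrite horner_comp !hornerE.
have := congX_horner Qc (ry N); rewrite Qcr /congX dvdp_subr //.
by rewrite dvdp_mull.
Qed.

Section ModularSeries.
Variables (K : countFieldType) (p s : nat).
Hypothesis charK : p \in [pchar K].
Hypothesis frobK : forall x : K, x ^+ p = x.
Hypothesis Ep : p = s.*2.+1.

Let p_gt0 : (0 < p)%N. Proof. by rewrite Ep. Qed.
Let s_ltp : (s.+1 < p)%N.
Proof.
have := prime_gt1 (pcharf_prime charK); rewrite Ep !ltnS double_gt0 -addnn.
by case: (s) => // k _; rewrite addSn ltnS leq_addl.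
Qed.

Local Notation sqrt := (trunc (sqrt_coef K)).

(** The square root of [1 - 4z] divided by [1 - 4z], that is, its inverse. *)
Fixpoint invsqrt_coef n : K :=
  if n is m.+1 then 4 * invsqrt_coef m + sqrt_coef K m.+1 else 1.

Local Notation invsqrt := (trunc invsqrt_coef).

Lemma catalan_disc_invsqrt N : congX N (catalan_disc K * invsqrt N) (sqrt N).
Proof.
apply/congXP => n lt_n; rewrite [RHS]coef_trunc // /catalan_disc mulrBl mul1r coefB.
rewrite -scalerAl coefZ coefXM coef_trunc //; case: n lt_n => [|n] lt_n /=.
  by rewrite mulr0 subr0.
by rewrite coef_trunc ?(ltnW lt_n) //; ring.
Qed.

Lemma catalan_discX_horner0 n : (catalan_disc K ^+ n).[0] = 1.
Proof. by rewrite !hornerE subr0 expr1n. Qed.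

Lemma catalan_disc_neq0 : (catalan_disc K).[0] != 0.
Proof. by rewrite -[catalan_disc K]expr1 catalan_discX_horner0 oner_neq0. Qed.

Lemma invsqrt_sqr N : congX N (catalan_disc K * invsqrt N ^+ 2) 1.
Proof.
apply: (congX_mulI catalan_disc_neq0); rewrite mulr1.
have := congX_exp 2 (catalan_disc_invsqrt N); rewrite exprMn expr2 mulrA => H.
apply: congX_trans (sqrt_coef_sqr K N); apply: congX_trans H.
by rewrite mulrA congX_refl.
Qed.

Lemma invsqrt_horner0 N : (invsqrt N.+1).[0] = 1.
Proof. by rewrite horner_coef0 coef_trunc. Qed.

(** Both sides are inverse square roots of [1 - 4z] with constant term 1, because
[1 + 2s = p]. *)
Lemma invsqrt_frob N : congX N (invsqrt N) (catalan_disc K ^+ s * invsqrt N ^+ p).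
Proof.
case: N => [|N]; first by rewrite /congX expr0 dvd1p.
apply: congX_sqr.
  rewrite hornerM catalan_discX_horner0 horner_exp !invsqrt_horner0 expr1n mulr1.
  exact: two_neq0 charK Ep.
apply: (congX_mulI catalan_disc_neq0); apply: congX_trans (invsqrt_sqr _) _.
apply: congX_sym; rewrite -(expr1n _ p).
have -> : catalan_disc K * (catalan_disc K ^+ s * invsqrt N.+1 ^+ p) ^+ 2 =
    (catalan_disc K * invsqrt N.+1 ^+ 2) ^+ p.
  by rewrite !exprMn [LHS]mulrA -(exprM _ s) muln2 -exprS -Ep expr2.
exact/congX_exp/invsqrt_sqr.
Qed.

Lemma sqrt_frob N : congX N (sqrt N) (catalan_disc K ^+ s.+1 * invsqrt N ^+ p).
Proof.
apply: congX_trans (congX_sym (catalan_disc_invsqrt N)) _.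
by rewrite exprS -mulrA; apply/congXMl/invsqrt_frob.
Qed.

Definition invsqrt_sqr_coef n : K := invsqrt_coef n ^+ 2.

(** By [coef_mul_frob] the congruence says that [f n] is a product of two
coefficients, a property that survives squaring. *)
Lemma hadamard_frob (f : nat -> K) (q : {poly K}) :
  (size q <= p)%N ->
  (forall N, congX N (trunc f N) (q * invsqrt N ^+ p)) ->
  forall N, congX N (trunc (fun n => f n ^+ 2) N)
    (hadamard_sqr q * trunc invsqrt_sqr_coef N ^+ p).
Proof.
move=> sq H N; apply/congXP => n lt_n.
have lt_d : (n %/ p < N)%N by apply: leq_ltn_trans lt_n; apply: leq_div.
rewrite (coef_mul_frob charK) ?size_hadamard_sqr // coef_hadamard_sqr !coef_trunc //.
have := congXP _ _ _ (H N) n lt_n.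
by rewrite (coef_mul_frob charK) // !coef_trunc // => ->; rewrite exprMn.
Qed.

(** The degree over F_p(z) of the generating function modulo [p] is at least
[p - 2]. *)
Theorem num_reduced_mod_relation (Q : {poly {poly K}}) :
  Q != 0 ->
  (forall N, 'X^N %| Q.[trunc (fun n => (num_reduced n)%:R) N]) ->
  (p <= (size Q).+1)%N.
Proof.
move=> Q0 Qr.
have Xw : 'X %| logistic K by rewrite dvdp_mulr.
have sy n : (n < p)%N -> (size (catalan_disc K ^+ n) <= p)%N.
  by rewrite (size_catalan_discX charK Ep).
pose gam N := trunc invsqrt_sqr_coef N \Po logistic K.
pose V := hasse_poly K s \Po logistic K.
pose E := hadamard_sqr (catalan_disc K ^+ s.+1) \Po logistic K.
have gamV N : congX N (gam N) (V * gam N ^+ p).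
  have := hadamard_frob (sy _ (ltnW s_ltp)) invsqrt_frob N => /(congX_comp Xw).
  by rewrite comp_polyM rmorphXn.
have gamE N : congX N (trunc (fun n => sqrt_coef K n ^+ 2) N \Po logistic K) (E * gam N ^+ p).
  have := hadamard_frob (sy _ s_ltp) sqrt_frob N => /(congX_comp Xw).
  by rewrite comp_polyM rmorphXn.
have sw : size (logistic K) = 3.
  have -> : logistic K = - ('X * ('X - 1%:P)) by rewrite /logistic polyC1; ring.
  by rewrite size_polyN size_Mmonic ?polyX_eq0 ?monicXsubC // size_polyX size_XsubC.
have sV : (size V).-1 = p.-1.
  by rewrite /V size_comp_poly sw (size_hasse charK Ep) Ep /= muln2.
have V0 : V != 0.
  rewrite -size_poly_gt0; have := prime_gt1 (pcharf_prime charK).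
  by move: sV; case: size => //; lia.
have E0 : E != 0.
  rewrite comp_poly_eq0 ?sw // -size_poly_gt0 size_hadamard_sqr.
  by rewrite (size_catalan_discX charK Ep).
have c0 : V * (4 *: 'X) != 0.
  by rewrite mulf_neq0 // scaler_eq0 polyX_eq0 orbF (four_neq0 charK Ep).
(* 4zR + 1 + 4w = E gamma^p; multiplying by V removes the power. *)
have [N|Q' [sQ' Q'0 Q'g]] := affine_relation (b := - (V * (1 + 4 *: logistic K)))
   (y := gam) c0 E0 Q0 _ Qr.
  rewrite /congX; have -> : V * (4 *: 'X) * trunc (fun n => (num_reduced n)%:R) N -
     (E * gam N - V * (1 + 4 *: logistic K)) =
    V * ((4 *: 'X * trunc (fun n => (num_reduced n)%:R) N + (1 + 4 *: logistic K))
      - E * gam N ^+ p) - E * (gam N - V * gam N ^+ p) by ring.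
  rewrite dvdp_sub // dvdp_mull //; last exact: gamV.
  exact: congX_trans (num_reduced_sqrt K N) (gamE N).
have cog N : coprimep 'X^N (gam N).
  case: N => [|N]; first by rewrite expr0 coprime1p.
  rewrite coprimepXn // horner_comp !hornerE horner_coef0 coef_trunc //.
  by rewrite /invsqrt_sqr_coef expr1n oner_neq0.
have [m [a [b [/andP [m0 lt_m] a0 Em]]]] := frobenius_relation charK V0 Q'0 cog gamV Q'g.
rewrite sQ' in lt_m; have [le_pm|lt_mp] := leqP p m.
  by apply: leq_trans le_pm _; apply: ltnW; apply: ltnW.
have coB : coprimep (hasse_poly K s) (hasse_poly K s)^`().
  apply: (legendre_ode_coprime charK (hasse_ode charK Ep) (hasse0 K s)).
  by rewrite (size_hasse charK Ep) ltnW.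
have := kummer_degree_bound charK coB sV _ a0 Em; rewrite m0 lt_mp => /(_ isT) /leq_trans -> //.
by rewrite addn2.
Qed.
End ModularSeries.

(** * Specializing linear relations to a finite field *)

(** A finite list of candidates and conditions that become stronger with [N]: if
every [N] admits a candidate, some candidate serves for all [N]. The conclusion
[False] keeps the argument constructive. *)
Lemma pigeonhole_antitone (V : eqType) (s : seq V) (P : nat -> pred V) :
  (forall M N v, (M <= N)%N -> P N v -> P M v) ->
  (forall N, has (P N) s) ->
  (forall v, v \in s -> (forall N, P N v) -> False) -> False.
Proof.
move=> mono; elim: s => [|v s IH] hasPs noP; first by have := hasPs 0%N.
apply: (noP v); first exact: mem_head.
move=> N0; have [//|nP] := boolP (P N0 v); case: IH => [N|u us]; last first.
  by apply: noP; rewrite inE us orbT.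
have /orP [Pv|/hasP [u us Pu]] := hasPs (maxn N N0).
  by move: nP; rewrite (mono _ _ _ (leq_maxr N N0) Pv).
by apply/hasP; exists u => //; apply: mono Pu; apply: leq_maxl.
Qed.

(** An integer determinant that is nonzero in [k] is nonzero, and [F] has
characteristic 0. *)
Lemma int_unitmx_specialize (k : fieldType) (F : numFieldType) n (A : 'M[int]_n) :
  map_mx (intr : int -> k) A \in unitmx -> map_mx (intr : int -> F) A \in unitmx.
Proof.
rewrite !unitmxE !unitfE !det_map_mx intr_eq0.
by apply: contraNneq => ->; rewrite rmorph0.
Qed.

(** If, for some [N], no nonzero vector over [k] annihilated the first [N] columns
of [m], these would contain an invertible square submatrix over [k], hence over
[F], against the relation [v]. As [k] is finite, one vector over [k] then works
for all [N]. *)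
Lemma int_relation_specialize (k : finFieldType) (F : numFieldType) (T : finType)
    (m : T -> nat -> int) (v : T -> F) t0 :
  v t0 != 0 -> (forall n, \sum_t v t * (m t n)%:~R = 0) ->
  (forall u : {ffun T -> k}, u != 0 ->
     (forall n, \sum_t u t * (m t n)%:~R = 0) -> False) -> False.
Proof.
move=> vt0 relF norel.
pose P N (u : {ffun T -> k}) :=
  (u != 0) && [forall n : 'I_N, \sum_t u t * (m t n)%:~R == 0].
apply: (@pigeonhole_antitone _ (enum {ffun T -> k}) P) => [M N u le_MN|N|u _ Pu].
- move=> /andP [u0 /forallP H]; rewrite /P u0; apply/forallP => n.
  exact: H (widen_ord le_MN n).
- apply/negPn/negP => /hasPn noP; case/negP: vt0.
  pose A : 'M[int]_(N, #|T|) := \matrix_(n, i) m (enum_val i) n.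
  have full : row_full (map_mx (intr : int -> k) A).
    rewrite /row_full -mxrank_tr -[_ == _]/(row_free _) -kermx_eq0.
    apply/rowV0P => x /sub_kermxP xA.
    pose u : {ffun T -> k} := [ffun t => x 0 (enum_rank t)].
    have : ~~ P N u by apply: noP; rewrite mem_enum.
    rewrite /P negb_and negbK => /orP [/eqP u0|/forallPn [n /negP []]].
      apply/rowP => i; rewrite mxE -[i]enum_valK.
      by have /ffunP /(_ (enum_val i)) := u0; rewrite !ffunE.
    apply/eqP; have := congr1 (fun y : 'rV_N => y 0 n) xA; rewrite !mxE => e.
    rewrite -[RHS]e {e}.
    rewrite (reindex (@enum_val T T)) /=; last first.
      by exists enum_rank => i _; rewrite (enum_valK, enum_rankK).
    by apply: eq_bigr => i _; rewrite !mxE ffunE enum_valK.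
  have := fullrowsub_unit full; rewrite -map_mxsub.
  move=> /(int_unitmx_specialize F); set D := map_mx _ _ => uD.
  pose x : 'cV[F]_#|T| := \col_i v (enum_val i).
  have Dx : D *m x = 0.
    apply/colP => i; rewrite !mxE.
    rewrite -[RHS](relF (fullrankfun full i)) [RHS](reindex (@enum_val T T)) /=; last first.
      by exists enum_rank => j _; rewrite (enum_valK, enum_rankK).
    by apply: eq_bigr => j _; rewrite !mxE mulrC.
  have /colP /(_ (enum_rank t0)) : x = 0 by rewrite -(mulKmx uD x) Dx mulmx0.
  by rewrite !mxE enum_rankK => ->.
- apply: (norel u) => [|n]; first by case/andP: (Pu 0).
  by have /andP [_ /forallP /(_ (@Ordinal n.+1 n (ltnSn n))) /eqP] := Pu n.+1.
Qed.

(** * Algebraic equations as linear relations *)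

Lemma fseries_exp_trunc (R : nzRingType) (f : fseries R) N k n : (n < N)%N ->
  fseries_exp f k n = (trunc f N ^+ k)`_n.
Proof.
elim: k n => [|k IH] n lt_n //; rewrite exprS coefM; apply: eq_bigr => i _.
rewrite -IH; last by apply: leq_ltn_trans lt_n; apply: leq_subr.
by rewrite coef_trunc // (leq_ltn_trans _ lt_n) // -ltnS.
Qed.

Lemma fseries_eval_trunc (R : nzRingType) (P : {poly {poly R}}) (f : fseries R) N n :
  (n < N)%N -> fseries_eval P f n = P.[trunc f N]`_n.
Proof.
move=> lt_n; rewrite horner_coef coef_sum; apply: eq_bigr => i _.
rewrite coefM; apply: eq_bigr => j _; congr (_ * _); apply: fseries_exp_trunc.
by apply: leq_ltn_trans lt_n; apply: leq_subr.
Qed.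

Lemma coef_sumXn (R : nzRingType) n (c : 'I_n -> R) (i : 'I_n) :
  (\sum_j c j *: 'X^j)`_i = c i.
Proof.
rewrite coef_sum (bigD1 i) //= coefZ coefXn eqxx mulr1 big1 ?addr0 // => j ji.
by rewrite coefZ coefXn eq_sym (inj_eq val_inj) (negPf ji) mulr0.
Qed.

(** Polynomials in two variables of bounded degrees, as vectors of coefficients:
in this form algebraic equations become linear relations between the series
z^j f^i. *)
Definition bipoly (R : nzRingType) D H (v : 'I_D * 'I_H -> R) : {poly {poly R}} :=
  \sum_i (\sum_j v (i, j) *: 'X^j) *: 'X^i.

Lemma horner_bipoly (R : comNzRingType) D H (v : 'I_D * 'I_H -> R) x n :
  (bipoly v).[x]`_n = \sum_t v t * ('X^(t.2) * x ^+ (t.1))`_n.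
Proof.
rewrite /bipoly horner_sum coef_sum.
transitivity (\sum_i \sum_j v (i, j) * ('X^j * x ^+ i)`_n).
  apply: eq_bigr => i _; rewrite hornerZ hornerXn mulr_suml coef_sum.
  by apply: eq_bigr => j _; rewrite -scalerAl coefZ.
by rewrite pair_bigA; apply: eq_bigr => -[].
Qed.

Lemma bipoly_coef (R : nzRingType) (P : {poly {poly R}}) H :
  (forall i, (size (P`_i)%R <= H)%N) ->
  bipoly (fun t : 'I_(size P) * 'I_H => P`_t.1`_t.2) = P.
Proof.
move=> sP; rewrite -[RHS]coefK poly_def; apply: eq_bigr => i _; congr (_ *: _).
transitivity (\poly_(j < H) P`_i`_j); first by rewrite poly_def.
apply/polyP => j; rewrite coef_poly; case: ltnP => // le_j.
by rewrite nth_default // (leq_trans (sP _)).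
Qed.

Lemma bipoly_eq0 (R : nzRingType) D H (v : 'I_D * 'I_H -> R) t :
  bipoly v = 0 -> v t = 0.
Proof.
case: t => i j /(congr1 (fun q : {poly {poly R}} => q`_i`_j)).
by rewrite /bipoly !coef_sumXn !coef0.
Qed.

Lemma size_bipoly (R : nzRingType) D H (v : 'I_D * 'I_H -> R) :
  (size (bipoly v) <= D)%N.
Proof.
apply: leq_trans (size_sum _ _ _) _; apply/bigmax_leqP => i _.
by apply: leq_trans (size_scale_leq _ _) _; rewrite size_polyXn.
Qed.

Definition monomial_coef D H (t : 'I_D * 'I_H) (n : nat) : int :=
  ('X^(t.2) * trunc (reduced_gf int) n.+1 ^+ (t.1))`_n.

Lemma monomial_coefE (K : fieldType) D H (t : 'I_D * 'I_H) n N : (n < N)%N ->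
  (monomial_coef t n)%:~R = ('X^(t.2) * trunc (reduced_gf K) N ^+ (t.1))`_n.
Proof.
move=> lt_n; rewrite -[LHS]/((intr : int -> K) _) -coef_map rmorphM !rmorphXn /= map_polyX.
have -> : map_poly (intr : int -> K) (trunc (reduced_gf int) n.+1) =
    trunc (reduced_gf K) n.+1.
  apply/polyP => i; rewrite coef_map !coef_poly; case: ifP => _ /=; last by rewrite rmorph0.
  by rewrite rmorph_nat.
apply/(congXP n.+1) => //; apply/congXMl/congX_exp/congXP => i lt_i.
by rewrite !coef_trunc //; apply: leq_trans lt_n.
Qed.

Theorem proposition5 (F : numFieldType) : ~ algebraic_series (reduced_gf F).
Proof.
case=> P P0 PR; set D := size P.
(* The degree of the equation is D - 1, while an equation modulo p has degree at
   least p - 2. *)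
have [p lt_p p_pr] := prime_above D.+1.
have charK := pchar_Fp p_pr.
have odd_p : odd p.
  case: (even_prime p_pr) => // p2; move: P0 lt_p.
  by rewrite -size_poly_gt0 -/D p2; case: D.
have Ep : p = (p./2).*2.+1 by rewrite -[LHS]odd_double_half odd_p.
have frobK (x : 'F_p) : x ^+ p = x by have := expf_card x; rewrite card_Fp.
pose H := \max_(i < D) size (P`_i)%R.
have sP i : (size (P`_i)%R <= H)%N.
  have [lt_i|le_i] := ltnP i D; first exact: (leq_bigmax (Ordinal lt_i)).
  by rewrite nth_default // size_poly0.
pose v (t : 'I_D * 'I_H) := P`_t.1`_t.2.
have [t vt] : exists t, v t != 0.
  apply/existsP; apply: contraNT P0 => /existsPn v0.
  rewrite -(bipoly_coef sP) /bipoly big1 // => i _; rewrite big1 ?scale0r // => j _.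
  by have := v0 (i, j); rewrite negbK => /eqP; rewrite /v /= => ->; rewrite scale0r.
apply: (@int_relation_specialize 'F_p F _ (@monomial_coef D H) v t vt) => [n|u u0 relu].
  rewrite -[RHS](PR n) (fseries_eval_trunc _ _ (ltnSn n)) -[in RHS](bipoly_coef sP).
  by rewrite horner_bipoly; apply: eq_bigr => s _; rewrite (monomial_coefE _ _ (ltnSn n)).
have Q0 : bipoly u != 0.
  apply: contraNneq u0 => Q0; apply/eqP/ffunP => s; rewrite ffunE.
  exact: bipoly_eq0 Q0.
suff : (p <= (size (bipoly u)).+1)%N.
  apply/negP; rewrite -ltnNge; apply: leq_ltn_trans lt_p.
  by rewrite ltnS size_bipoly.
apply: (num_reduced_mod_relation charK frobK Ep Q0) => N.
apply/dvdXnP => n lt_n; rewrite horner_bipoly -[RHS](relu n).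
by apply: eq_bigr => s _; rewrite (monomial_coefE _ _ lt_n).
Qed.
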